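(* Let $\mathbb{X}$ be a real vector space with Hamel basis $(\mathbf b_l)_{l\in I}$, let $k\in\mathbb N$ and let $\bm\alpha=(\alpha_l)_{l\in I}$ with $\alpha_l\in(0,1)$ for every $l\in I$. The component-wise quantile $\mathbf q_{Hamel,\bm\alpha}$ exists and is unique. If $\mathbb X$ is endowed with the topology induced by $\|\cdot\|_{\mathbb X,Hamel}$, then $\mathbf q_{Hamel,\bm\alpha}$ is Lipschitz continuous: for every $\mathbf x_1,\dots,\mathbf x_k,\mathbf z_1,\dots,\mathbf z_k\in\mathbb X$, $$\|\mathbf q_{Hamel,\bm\alpha}(\mathbf x_1,\dots,\mathbf x_k)-\mathbf q_{Hamel,\bm\alpha}(\mathbf z_1,\dots,\mathbf z_k)\|_{\mathbb X,Hamel}\le\|(\mathbf x_1,\dots,\mathbf x_k)-(\mathbf z_1,\dots,\mathbf z_k)\|_{\mathbb X,Hamel,k}.$$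
   Context: Univariate quantile: for $\alpha\in(0,1)$ and $\mathbf x\in\mathbb R^k$ with increasingly ordered components $\tilde x_1\le\dots\le\tilde x_k$, $q_\alpha(\mathbf x)=\frac12(\tilde x_{\lceil k\alpha\rceil}+\tilde x_{\lfloor k\alpha+1\rfloor})$. For $\mathbf x_i=\sum_{l\in I}x_i^{(l)}\mathbf b_l$ (finitely many non-zero coefficients), $i=1,\dots,k$, the component-wise quantile with respect to the Hamel basis is $\mathbf q_{Hamel,\bm\alpha}(\mathbf x_1,\dots,\mathbf x_k)=\sum_{l\in I}q_{\alpha_l}(x_1^{(l)},\dots,x_k^{(l)})\,\mathbf b_l$; its existence means that this expression defines an element of $\mathbb X$. Norms: $\|\sum_{l\in I}x^{(l)}\mathbf b_l\|_{\mathbb X,Hamel}=\sum_{l\in I}|x^{(l)}|$, and $\|(\mathbf x_1,\dots,\mathbf x_k)\|_{\mathbb X,Hamel,k}=\sum_{i=1}^k\|\mathbf x_i\|_{\mathbb X,Hamel}$ on $\mathbb X^k$. *)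

(* Defs.v *)
From HB Require Import structures.
From mathcomp Require Import all_boot all_order all_algebra.
From mathcomp Require Import boolp classical_sets functions cardinality fsbigop.
From mathcomp Require Import reals.

Set Implicit Arguments.
Unset Strict Implicit.
Unset Printing Implicit Defensive.

Import Order.TTheory GRing.Theory Num.Theory.

Local Open Scope classical_set_scope.
Local Open Scope ring_scope.

Section Quantile.
Variables (R : realType) (k : nat).

(* Ordered components are numbered from 1, hence the predecessor; for k > 0
   and 0 < a < 1 both indices used in [quantile] lie between 1 and k. *)
Definition order_stat (x : 'I_k -> R) (n : nat) : R :=
  (sort <=%R (codom x))`_n.-1.

Definition quantile (a : R) (x : 'I_k -> R) : R :=
  2^-1 * (order_stat x `|Num.ceil (k%:R * a)|%N
          + order_stat x `|Num.floor (k%:R * a + 1)|%N).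

End Quantile.

Section Hamel.
Variables (R : realType) (X : lmodType R) (I : choiceType) (b : I -> X).

(* The finitary sum is 0 by convention when infinitely many terms are nonzero,
   so finiteness is required separately in [hamel_expansion]. *)
Definition hamel_comb (c : I -> R) : X := \sum_(l \in [set: I]) c l *: b l.

Definition hamel_expansion (x : X) (c : I -> R) : Prop :=
  finite_set [set l | c l != 0] /\ x = hamel_comb c.

Definition hamel_basis : Prop :=
  (forall c : I -> R, hamel_expansion 0 c -> forall l, c l = 0) /\
  (forall x : X, exists c : I -> R, hamel_expansion x c).

Definition hamel_coord (x : X) : I -> R :=
  xget (fun=> 0) [set c | hamel_expansion x c].

Definition hamel_norm (x : X) : R :=
  \sum_(l \in [set: I]) `|hamel_coord x l|.

Section Tuples.
Variable k : nat.

Definition hamel_norm_tuple (x : 'I_k -> X) : R :=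
  \sum_(i < k) hamel_norm (x i).

Variable alpha : I -> R.

(* [y] is a component-wise quantile of [x]: the expression
   sum_l q_(alpha l) (x_1^(l), ..., x_k^(l)) b_l, for some expansions of the
   x_i, has finitely many nonzero coefficients and is equal to [y]. *)
Definition is_hamel_quantile (x : 'I_k -> X) (y : X) : Prop :=
  exists2 c : 'I_k -> I -> R,
    (forall i, hamel_expansion (x i) (c i)) &
    hamel_expansion y (fun l => quantile (alpha l) (fun i => c i l)).

Definition hamel_quantile (x : 'I_k -> X) : X :=
  hamel_comb (fun l => quantile (alpha l) (fun i => hamel_coord (x i) l)).

End Tuples.
End Hamel.

(* Main.v *)
Require Import Defs.
From HB Require Import structures.
From mathcomp Require Import all_boot all_order all_algebra.
From mathcomp Require Import boolp classical_sets functions cardinality fsbigop.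
From mathcomp Require Import reals finmap.

(** Existence: a coordinate that vanishes for each of [x_1, ..., x_k] has
    quantile [0] ([quantile0]), so the nonzero coefficients of the quantile are
    confined to the union of [k] finite supports.  Uniqueness: expansions in a
    Hamel basis are unique ([hamel_expansion_inj]), so the coefficients fed to
    the univariate quantiles cannot be chosen differently.

    Lipschitz bound: everything rests on the univariate estimate
    [| q_a(x) - q_a(z) | <= sum_i | x_i - z_i |] ([quantile_dist]).  It holds
    because raising every observation by at most [d] raises every order
    statistic by at most [d]: the number of observations not exceeding
    [t + d] after the change is at least the number of those not exceeding [t]
    before ([order_stat_leD]).  Fixing one finite set of basis indices that contains
    all the supports involved turns the Hamel norms into finite sums over that
    set; summing the univariate estimate over it, with [alpha] depending on the
    coordinate, and exchanging the two summations gives the claim. *)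

Set Implicit Arguments.
Unset Strict Implicit.
Unset Printing Implicit Defensive.

Import Order.TTheory GRing.Theory Num.Theory.

Local Open Scope ring_scope.

Section UnivariateQuantile.
Context {R : realType} {k : nat}.
Implicit Types (x z : 'I_k -> R) (a d : R).

(** For [1 <= n], the order statistic of index [n] is at most a given bound as
    soon as at least [n] observations are.  With [t] the order statistic of
    [z], at least [n] of the [z i] are at most [t], and each of them yields an
    [x i] that is at most [t + d]. *)
Lemma order_stat_leD x z d n : 0 <= d -> (forall i, x i <= z i + d) ->
  order_stat x n <= order_stat z n + d.
Proof.
move=> d0 xz; rewrite /order_stat; set m := n.-1.
have szs (y : 'I_k -> R) : size (sort <=%R (codom y)) = k :> nat.
  by rewrite size_sort size_codom card_ord.
have srt (y : 'I_k -> R) : sorted <=%R (sort <=%R (codom y)).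
  exact: (sort_sorted le_total).
have [km|mk] := leqP k m.
  (* both terms are the default value of nth *)
  by rewrite !nth_default ?szs// add0r.
set t := (X in _ <= X + _).
have mz : (m < count (<= t)%O (codom z))%N.
  rewrite -(count_sort <=%R) ltnNge; apply/negP => cm.
  have : t < t.
    by apply: nth_count_gt => //; rewrite cm szs.
  by rewrite ltxx.
apply: nth_count_le => //; rewrite count_sort (leq_trans mz)//.
rewrite /codom /image_mem !count_map; apply: sub_count => i /= zt.
by rewrite (le_trans (xz i))// lerD2r.
Qed.

(** Both one-sided comparisons are [order_stat_leD] with [d] the whole sum,
    which dominates each single deviation. *)
Lemma order_stat_dist x z n :
  `|order_stat x n - order_stat z n| <= \sum_i `|x i - z i|.
Proof.
have d0 : 0 <= \sum_i `|x i - z i| by apply: sumr_ge0.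
have le_d i : `|x i - z i| <= \sum_i `|x i - z i|.
  by rewrite (bigD1 i)//= lerDl sumr_ge0.
rewrite ler_distl lerBlDr; apply/andP; split; apply: order_stat_leD => // i.
  by move: (le_d i); rewrite ler_distl lerBlDr => /andP[].
by move: (le_d i); rewrite ler_distl => /andP[].
Qed.

Lemma quantile_dist a x z :
  `|quantile a x - quantile a z| <= \sum_i `|x i - z i|.
Proof.
rewrite /quantile -mulrBr opprD addrACA normrM ger0_norm ?invr_ge0//.
rewrite mulrC ler_pdivrMr// mulr_natr mulr2n.
by rewrite (le_trans (ler_normD _ _))// lerD// order_stat_dist.
Qed.

Lemma quantile0 a x : (forall i, x i = 0) -> quantile a x = 0.
Proof.
move=> x0; have os0 n : order_stat x n = 0.
  rewrite /order_stat; have [?|sz] := leqP (size (sort <=%R (codom x))) n.-1.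
    by rewrite nth_default.
  by have := mem_nth 0 sz; rewrite mem_sort => /codomP[i ->].
by rewrite /quantile !os0 addr0 mulr0.
Qed.

End UnivariateQuantile.

Section HamelBasis.
Context {R : realType} {X : lmodType R} {I : choiceType}.
Variable b : I -> X.
Implicit Types (x y : X) (c : I -> R).

(** Working with any finite set [A] outside of which the coefficients vanish,
    rather than with their exact support, lets several vectors share one index
    set, so that their combinations and norms can be added termwise. *)
Lemma hamel_comb_fset (A : {fset I}) c : (forall l, l \notin A -> c l = 0) ->
  hamel_comb b c = \sum_(l <- A) c l *: b l.
Proof. by move=> c0; apply: fsbigTE => l /c0 ->; rewrite scale0r. Qed.

Lemma hamel_expansion_fset {x c} : hamel_expansion b x c ->
  exists A : {fset I}, forall l, l \notin A -> c l = 0.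
Proof.
move=> [fc _]; exists (fset_set [set l | c l != 0]%classic) => l.
by rewrite in_fset_set// notin_setE /= => /negP; rewrite negbK => /eqP.
Qed.

Lemma fset_hamel_expansion (A : {fset I}) c :
  (forall l, l \notin A -> c l = 0) -> hamel_expansion b (hamel_comb b c) c.
Proof.
move=> c0; split=> //; apply: (sub_finite_set _ (finite_fset A)) => l /=.
by apply: contra_neqT => /c0.
Qed.

Lemma hamel_expansionB x y c c' :
  hamel_expansion b x c -> hamel_expansion b y c' ->
  hamel_expansion b (x - y) (fun l => c l - c' l).
Proof.
move=> xc yc'; have [A cA] := hamel_expansion_fset xc.
have [A' cA'] := hamel_expansion_fset yc'; pose B := (A `|` A')%fset.
have cB l : l \notin B -> c l = 0 by rewrite inE negb_or => /andP[/cA].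
have cB' l : l \notin B -> c' l = 0 by rewrite inE negb_or => /andP[_ /cA'].
have dB l : l \notin B -> c l - c' l = 0.
  by move=> lB; rewrite cB// cB'// subrr.
suff -> : x - y = hamel_comb b (fun l => c l - c' l).
  exact: fset_hamel_expansion dB.
rewrite xc.2 yc'.2 (hamel_comb_fset dB) (hamel_comb_fset cB).
rewrite (hamel_comb_fset cB') -sumrB.
by apply: eq_bigr => l _; rewrite scalerBl.
Qed.

Hypothesis hb : hamel_basis b.

Lemma hamel_expansion_inj {x c c'} :
  hamel_expansion b x c -> hamel_expansion b x c' -> c = c'.
Proof.
move=> xc xc'; apply/funext => l; apply/eqP; rewrite -subr_eq0; apply/eqP.
by apply: (hb.1 (fun l => c l - c' l)); rewrite -(subrr x); exact: hamel_expansionB.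
Qed.

Lemma hamel_coordP x : hamel_expansion b x (hamel_coord b x).
Proof. by have [c xc] := hb.2 x; apply: xgetPex; exists c. Qed.

Lemma hamel_coordE x c : hamel_expansion b x c -> hamel_coord b x = c.
Proof. by move=> xc; apply: hamel_expansion_inj (hamel_coordP x) xc. Qed.

Lemma hamel_coordB x y l :
  hamel_coord b (x - y) l = hamel_coord b x l - hamel_coord b y l.
Proof.
by rewrite (hamel_coordE (hamel_expansionB (hamel_coordP x) (hamel_coordP y))).
Qed.

Lemma hamel_norm_fset (A : {fset I}) x :
  (forall l, l \notin A -> hamel_coord b x l = 0) ->
  hamel_norm b x = \sum_(l <- A) `|hamel_coord b x l|.
Proof. by move=> x0; apply: fsbigTE => l /x0 ->; rewrite normr0. Qed.

Lemma hamel_coord_fset {k} (x : 'I_k -> X) :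
  exists A : {fset I}, forall i l, l \notin A -> hamel_coord b (x i) l = 0.
Proof.
have [A xA] := choice (fun i => hamel_expansion_fset (hamel_coordP (x i))).
exists (\bigcup_(i <- enum 'I_k) A i)%fset => i l lA; apply: xA.
by apply: contra lA => lA; apply/bigfcupP; exists i; rewrite ?mem_enum.
Qed.

Variables (k : nat) (alpha : I -> R).

Lemma hamel_quantile_expansion (x : 'I_k -> X) :
  hamel_expansion b (hamel_quantile b alpha x)
    (fun l => quantile (alpha l) (fun i => hamel_coord b (x i) l)).
Proof.
have [A xA] := hamel_coord_fset x.
by apply: (@fset_hamel_expansion A) => l lA; apply: quantile0 => i; apply: xA.
Qed.

Lemma hamel_coord_quantile (x : 'I_k -> X) l :
  hamel_coord b (hamel_quantile b alpha x) l =
  quantile (alpha l) (fun i => hamel_coord b (x i) l).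
Proof. by rewrite (hamel_coordE (hamel_quantile_expansion x)). Qed.

Lemma is_hamel_quantile_hamel_quantile (x : 'I_k -> X) :
  is_hamel_quantile b alpha x (hamel_quantile b alpha x).
Proof.
exists (fun i => hamel_coord b (x i)); last exact: hamel_quantile_expansion.
by move=> i; exact: hamel_coordP.
Qed.

(** The expansions hidden in [is_hamel_quantile] have to be the coordinates of
    the [x i], by [hamel_expansion_inj]. *)
Lemma is_hamel_quantile_uniq (x : 'I_k -> X) y :
  is_hamel_quantile b alpha x y -> y = hamel_quantile b alpha x.
Proof.
move=> [c xc [_ ->]]; rewrite /hamel_quantile.
by under [in RHS]eq_fun do under eq_fun do rewrite (hamel_coordE (xc _)).
Qed.

Lemma hamel_quantile_lipschitz (x z : 'I_k -> X) :
  hamel_norm b (hamel_quantile b alpha x - hamel_quantile b alpha z)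
    <= hamel_norm_tuple b (fun i => x i - z i).
Proof.
have [A xA] := hamel_coord_fset x; have [B zB] := hamel_coord_fset z.
pose C := (A `|` B)%fset.
have xzC l : l \notin C -> forall i,
    hamel_coord b (x i) l = 0 /\ hamel_coord b (z i) l = 0.
  by rewrite inE negb_or => /andP[lA lB] i; rewrite xA ?zB.
rewrite (@hamel_norm_fset C); last first.
  move=> l /xzC xz0; rewrite hamel_coordB !hamel_coord_quantile.
  by rewrite !quantile0 ?subrr// => i; case: (xz0 i).
rewrite /hamel_norm_tuple.
under [leRHS]eq_bigr => i _.
  rewrite (@hamel_norm_fset C); last first.
    by move=> l /xzC /(_ i)[x0 z0]; rewrite hamel_coordB x0 z0 subrr.
  under eq_bigr do rewrite hamel_coordB.
  over.
rewrite exchange_big /=; apply: ler_sum => l _.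
by rewrite hamel_coordB !hamel_coord_quantile quantile_dist.
Qed.

End HamelBasis.

Theorem theorem4p3 (R : realType) (X : lmodType R) (I : choiceType)
    (b : I -> X) (hb : hamel_basis b) (k : nat) (hk : (0 < k)%N)
    (alpha : I -> R) (halpha : forall l : I, 0 < alpha l < 1) :
  (forall x : 'I_k -> X,
     is_hamel_quantile b alpha x (hamel_quantile b alpha x) /\
     (forall y : X, is_hamel_quantile b alpha x y ->
        y = hamel_quantile b alpha x)) /\
  (forall x z : 'I_k -> X,
     hamel_norm b (hamel_quantile b alpha x - hamel_quantile b alpha z)
       <= hamel_norm_tuple b (fun i => x i - z i)).
Proof.
split=> [x|x z]; last exact: hamel_quantile_lipschitz.
split=> [|y]; first exact: is_hamel_quantile_hamel_quantile.
exact: is_hamel_quantile_uniq.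
Qed.
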